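(* Let $\mathfrak g$ be the complexified holonomy algebra with complexified holonomy representation $T$, let $\mathfrak h\subset\mathfrak g$ be (the complexification of) an ideal, and let $V_\lambda$ be an irreducible representation of $\mathfrak g$. Write $K=K^{\mathfrak h}$ and $B=B^{\mathfrak h}$. Then the actions of $K$, $B$ and $\tau$ on $\mathfrak W(V_\lambda)=\mathrm{Hom}_{\mathfrak g}(T\otimes T\otimes V_\lambda,V_\lambda)$ by precomposition satisfy $$K+B+\tau B\tau\;=\;\mathrm{Cas}^{\Lambda^2}_T\;=\;-2\,\frac{\dim\mathfrak h}{\dim T}.$$
   Context: Setting: $\mathfrak g_{\mathbb R}\subset\mathfrak{so}(T_{\mathbb R})$ is an irreducible non-symmetric Riemannian holonomy algebra with its holonomy representation $T_{\mathbb R}$, i.e. one of $\mathfrak{so}_n$ on $\mathbb R^n$, $\mathfrak u_n$ or $\mathfrak{su}_n$ on $\mathbb C^n$, $\mathfrak{sp}(1)\oplus\mathfrak{sp}(n)$ on $\mathbb H^n$, $\mathfrak{sp}(n)$ on $\mathbb H^n$, $\mathfrak g_2$ on $\mathbb R^7$, $\mathfrak{spin}_7$ on the spinor representation $\mathbb R^8$. $T=T_{\mathbb R}\otimes\mathbb C$ carries the $\mathbb C$-bilinear extension $\langle\cdot,\cdot\rangle$ of the scalar product; $\mathfrak g=\mathfrak g_{\mathbb R}\otimes\mathbb C$. $\Lambda^2T$ carries the scalar product given by Gram's determinant and $\mathfrak{so}(T)\cong\Lambda^2T$ via $\langle X,a\wedge b\rangle=\langle Xa,b\rangle$; the induced scalar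 product is $\langle X,Y\rangle=-\frac12\mathrm{tr}_T(XY)$. $\{X_\alpha\}$ denotes an orthonormal basis of $\mathfrak h\subset\Lambda^2T$ for this scalar product. Operators on $T\otimes T\otimes V_\lambda$ (acting on $\mathfrak W(V_\lambda)$ by precomposition $F\mapsto F\circ(\cdot)$): $\tau(a\otimes b\otimes v)=b\otimes a\otimes v$; $K^{\mathfrak h}(a\otimes b\otimes v)=-\sum_\alpha X_\alpha a\otimes X_\alpha b\otimes v$; $B^{\mathfrak h}(a\otimes b\otimes v)=-\sum_\alpha a\otimes X_\alpha b\otimes X_\alpha v$. $\mathrm{Cas}^{\Lambda^2}=\sum_\alpha X_\alpha^2$ is the Casimir operator of $\mathfrak h$ in this normalization; it acts on $T$ as a scalar, denoted $\mathrm{Cas}^{\Lambda^2}_T$. *)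

(* Defs.v *)
(* Mathematical Components, with complex numbers R[i] over R : realType and
   the Kronecker product *t of mathcomp-real-closed as tensor product. *)
From HB Require Import structures.
From mathcomp Require Import all_boot all_order all_algebra.
From mathcomp Require Import reals.
From mathcomp Require Export complex mxtens.

Set Implicit Arguments.
Unset Strict Implicit.
Unset Printing Implicit Defensive.

Import Order.TTheory GRing.Theory Num.Theory.
Local Open Scope ring_scope.

Definition lie_bracket (F : fieldType) (n : nat) (X Y : 'M[F]_n) : 'M[F]_n :=
  X *m Y - Y *m X.

Definition is_ideal (F : fieldType) (n : nat) (g h : {vspace 'M[F]_n}) : Prop :=
  (h <= g)%VS /\
  (forall X Y, X \in g -> Y \in h -> lie_bracket X Y \in h).

(* R^n carries its standard scalar product, C^n is R^(n * 2) = R^n (x) C and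
   H^n is R^(n * 4) = R^n (x) H, in the real bases (1, i) and (1, i, j, k). *)
Section RealAlgebras.
Variable R : realType.

Definition so_alg (N : nat) : {vspace 'M[R]_N} :=
  lker (linfun (@trmx R N N) + \1)%VF.

Definition commutant (N : nat) (J : 'M[R]_N) : {vspace 'M[R]_N} :=
  lker (linfun (mulmx J) - linfun (mulmxr J))%VF.

Definition mx_of_rows (n : nat) (s : seq (seq int)) : 'M[R]_n :=
  \matrix_(r < n, c < n) (nth 0 (nth [::] s r) c)%:~R.

Definition mul_i : 'M[R]_2 := mx_of_rows 2 [:: [:: 0; -1]; [:: 1; 0]].

Definition complex_structure (n : nat) : 'M[R]_(n * 2) := 1%:M *t mul_i.

Definition u_alg (n : nat) : {vspace 'M[R]_(n * 2)} :=
  (so_alg (n * 2) :&: commutant (complex_structure n))%VS.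

(* For a C-linear X the complex trace is (tr X - i tr (J X)) / 2, and
   tr X = 0 when X is skew. *)
Definition su_alg (n : nat) : {vspace 'M[R]_(n * 2)} :=
  (u_alg n :&:
   lker (linfun (fun X => \tr (complex_structure n *m X) : R^o)))%VS.

(* Right multiplications by i, j, k on H. *)
Definition rmul_i : 'M[R]_4 := mx_of_rows 4
  [:: [:: 0; -1; 0;  0];
      [:: 1;  0; 0;  0];
      [:: 0;  0; 0;  1];
      [:: 0;  0; -1; 0]].
Definition rmul_j : 'M[R]_4 := mx_of_rows 4
  [:: [:: 0;  0; -1;  0];
      [:: 0;  0;  0; -1];
      [:: 1;  0;  0;  0];
      [:: 0;  1;  0;  0]].
Definition rmul_k : 'M[R]_4 := mx_of_rows 4
  [:: [:: 0;  0;  0; -1];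
      [:: 0;  0;  1;  0];
      [:: 0; -1;  0;  0];
      [:: 1;  0;  0;  0]].

Definition quaternionic_structures (n : nat) : seq 'M[R]_(n * 4) :=
  [:: 1%:M *t rmul_i; 1%:M *t rmul_j; 1%:M *t rmul_k].

Definition sp_alg (n : nat) : {vspace 'M[R]_(n * 4)} :=
  (so_alg (n * 4) :&:
   \bigcap_(J <- quaternionic_structures n) commutant J)%VS.

(* sp(1) acts on H^n by right multiplications with imaginary quaternions. *)
Definition sp1_sp_alg (n : nat) : {vspace 'M[R]_(n * 4)} :=
  (<<quaternionic_structures n>> + sp_alg n)%VS.

(* The octonions have imaginary units e_0, ..., e_6 with products
   e_a e_(a+1) = e_(a+3), indices mod 7, and their cyclic rotations. *)
Definition fano_line (a b c : nat) : bool :=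
  (b == (a + 1) %% 7)%N && (c == (a + 3) %% 7)%N.

Definition fano (a b c : nat) : bool :=
  [|| fano_line a b c, fano_line b c a | fano_line c a b].

Definition oct_form (a b c : 'I_7) : R := (fano a b c)%:R - (fano b a c)%:R.

(* The matrix of x |-> e_a \times x on Im O = R^7. *)
Definition oct_cross (a : 'I_7) : 'M[R]_7 :=
  \matrix_(c < 7, b < 7) oct_form a b c.

(* The operator y |-> X (e_a \times y) - e_a \times X y - (X e_a) \times y. *)
Definition derivation_defect (a : 'I_7) (X : 'M[R]_7) : 'M[R]_7 :=
  X *m oct_cross a - oct_cross a *m X - \sum_(b < 7) X b a *: oct_cross b.

Definition g2_alg : {vspace 'M[R]_7} :=
  (so_alg 7 :&: \bigcap_(a < 7) lker (linfun (derivation_defect a)))%VS.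

(* Left multiplication by e_a on O = R 1 (+) Im O. These seven operators make
   R^8 the spinor module of the Clifford algebra, see [oct_cliffordP]. *)
Definition oct_clifford (a : 'I_7) : 'M[R]_(1 + 7) :=
  block_mx 0 (- delta_mx 0 a) (delta_mx a 0) (oct_cross a).

Definition spin7_alg : {vspace 'M[R]_8} :=
  (\sum_(a < 7) \sum_(b < 7 | (a < b)%N)
     <[(oct_clifford a *m oct_clifford b : 'M[R]_8)]>)%VS.

(* The ranges of n are those for which the representation is irreducible and
   the algebra is nonzero. *)
Inductive holonomy_algebra : forall N : nat, {vspace 'M[R]_N} -> Prop :=
| Hol_so n of (2 <= n)%N : holonomy_algebra (so_alg n)
| Hol_u n of (1 <= n)%N : holonomy_algebra (u_alg n)
| Hol_su n of (2 <= n)%N : holonomy_algebra (su_alg n)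
| Hol_sp1_sp n of (1 <= n)%N : holonomy_algebra (sp1_sp_alg n)
| Hol_sp n of (1 <= n)%N : holonomy_algebra (sp_alg n)
| Hol_g2 : holonomy_algebra g2_alg
| Hol_spin7 : holonomy_algebra spin7_alg.

Definition complexify (N : nat) (g : {vspace 'M[R]_N}) : {vspace 'M[R[i]]_N} :=
  <<[seq map_mx (real_complex R) X | X <- vbasis g]>>%VS.

End RealAlgebras.

Section Complex.
Variable C : fieldType.

(* The bilinear scalar product on T = 'cV[C]_N. *)
Definition bilin (N : nat) (a b : 'cV[C]_N) : C := \sum_i a i 0 * b i 0.

Definition lam2_form (N : nat) (X Y : 'M[C]_N) : C :=
  - (2%:R^-1 * \tr (X *m Y)).

(* The element of so(T) corresponding to a /\ b, see [lam2_form_wedge]. *)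
Definition wedge (N : nat) (a b : 'cV[C]_N) : 'M[C]_N :=
  b *m a^T - a *m b^T.

Definition orthonormal_basis (N d : nat) (h : {vspace 'M[C]_N})
    (Xs : d.-tuple 'M[C]_N) : Prop :=
  basis_of h Xs /\
  (forall i j : 'I_d, lam2_form (tnth Xs i) (tnth Xs j) = (i == j)%:R).

Definition is_representation (N m : nat) (g : {vspace 'M[C]_N})
    (rho : 'M[C]_N -> 'M[C]_m) : Prop :=
  (forall (c : C) X Y, X \in g -> Y \in g ->
     rho (c *: X + Y) = c *: rho X + rho Y) /\
  (forall X Y, X \in g -> Y \in g ->
     rho (lie_bracket X Y) = lie_bracket (rho X) (rho Y)).

Definition is_irreducible (N m : nat) (g : {vspace 'M[C]_N})
    (rho : 'M[C]_N -> 'M[C]_m) : Prop :=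
  (0 < m)%N /\
  (forall U : {vspace 'cV[C]_m},
     (forall X u, X \in g -> u \in U -> rho X *m u \in U) ->
     U = 0%VS \/ U = fullv).

(* T (x) T (x) V is 'cV[C]_(N * N * m), with pure tensors a *t b *t v. *)
Definition tensor_action (N m : nat) (rho : 'M[C]_N -> 'M[C]_m) (X : 'M[C]_N) :
    'M[C]_(N * N * m) :=
  X *t 1%:M *t 1%:M + 1%:M *t X *t 1%:M + 1%:M *t 1%:M *t rho X.

(* F belongs to Hom_g (T (x) T (x) V, V). *)
Definition in_W (N m : nat) (g : {vspace 'M[C]_N}) (rho : 'M[C]_N -> 'M[C]_m)
    (F : 'M[C]_(m, N * N * m)) : Prop :=
  forall X, X \in g -> F *m tensor_action rho X = rho X *m F.

Definition swap_mx (N : nat) : 'M[C]_(N * N) := \matrix_(k, l)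
  (mxtens_unindex k == ((mxtens_unindex l).2, (mxtens_unindex l).1))%:R.

Definition tau_op (N m : nat) : 'M[C]_(N * N * m) := swap_mx N *t 1%:M.

Definition K_op (N m d : nat) (Xs : d.-tuple 'M[C]_N) : 'M[C]_(N * N * m) :=
  - \sum_(i < d) tnth Xs i *t tnth Xs i *t 1%:M.

Definition B_op (N m d : nat) (rho : 'M[C]_N -> 'M[C]_m)
    (Xs : d.-tuple 'M[C]_N) : 'M[C]_(N * N * m) :=
  - \sum_(i < d) 1%:M *t tnth Xs i *t rho (tnth Xs i).

Definition casimir (N d : nat) (Xs : d.-tuple 'M[C]_N) : 'M[C]_N :=
  \sum_(i < d) tnth Xs i *m tnth Xs i.

End Complex.

Section RealAlgebrasTheory.
Variable R : realType.

Lemma mem_lker (U W : vectType R) (f : U -> W) (u : U) :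
  linear f -> (u \in lker (linfun f)) = (f u == 0).
Proof.
move=> lin; pose L := GRing.isLinear.Build R U W _ f lin.
pose ff : {linear U -> W} := HB.pack f L.
by rewrite memv_ker -[f]/(ff : U -> W) lfunE.
Qed.

Lemma mem_so_alg N (X : 'M[R]_N) : (X \in so_alg R N) = (X^T == - X).
Proof. by rewrite memv_ker add_lfunE lfunE id_lfunE /= addr_eq0. Qed.

Lemma mem_commutant N (J X : 'M[R]_N) :
  (X \in commutant J) = (J *m X == X *m J).
Proof. by rewrite memv_ker add_lfunE opp_lfunE !lfunE /= subr_eq0. Qed.

Lemma mem_u_alg n (X : 'M[R]_(n * 2)) :
  (X \in u_alg R n) = (X^T == - X) &&
    (complex_structure R n *m X == X *m complex_structure R n).
Proof. by rewrite memv_cap mem_so_alg mem_commutant. Qed.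

Lemma mem_su_alg n (X : 'M[R]_(n * 2)) :
  (X \in su_alg R n) = (X \in u_alg R n) &&
    (\tr (complex_structure R n *m X) == 0).
Proof.
have lin : linear (fun X : 'M[R]_(n * 2) =>
    \tr (complex_structure R n *m X) : R^o).
  by move=> c Y Z; rewrite mulmxDr -scalemxAr linearP.
by rewrite memv_cap mem_lker.
Qed.

Lemma mem_sp_alg n (X : 'M[R]_(n * 4)) :
  (X \in sp_alg R n) = (X^T == - X) &&
    all (fun J => J *m X == X *m J) (quaternionic_structures R n).
Proof.
rewrite memv_cap mem_so_alg !big_cons big_nil /= !memv_cap !mem_commutant.
by rewrite memvf.
Qed.

Lemma derivation_defect_linear a : linear (@derivation_defect R a).
Proof.
move=> c X Y; rewrite /derivation_defect mulmxDl mulmxDr -scalemxAl -scalemxAr.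
have -> : \sum_(b < 7) (c *: X + Y) b a *: oct_cross R b =
    c *: (\sum_(b < 7) X b a *: oct_cross R b) +
    \sum_(b < 7) Y b a *: oct_cross R b.
  rewrite scaler_sumr -big_split; apply: eq_bigr => b _ /=.
  by rewrite !mxE scalerDl scalerA.
rewrite !scalerDr !scalerN !opprD.
by rewrite [X in X + _ = _]addrACA [LHS]addrACA.
Qed.

Lemma mem_g2_alg (X : 'M[R]_7) :
  (X \in g2_alg R) = (X^T == - X) && [forall a, derivation_defect a X == 0].
Proof.
rewrite memv_cap mem_so_alg; congr (_ && _).
apply/idP/forallP => [X0 a|X0].
  rewrite -(mem_lker _ (@derivation_defect_linear a)).
  exact: (subvP (bigcapv_inf a isT (subvv _)) X X0).
rewrite memvE; apply/subv_bigcapP => a _.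
by rewrite -memvE mem_lker ?X0 //; apply: derivation_defect_linear.
Qed.

Let clifford_entry (a r c : nat) : int :=
  match r, c with
  | 0%N, 0%N => 0
  | 0%N, c'.+1 => - (a == c')%:R
  | r'.+1, 0%N => (r' == a)%:R
  | r'.+1, c'.+1 => (fano a c' r')%:R - (fano c' a r')%:R
  end.

Let oct_cliffordE (a : 'I_7) :
  oct_clifford R a = \matrix_(r, c) (clifford_entry a r c)%:~R.
Proof.
apply/matrixP => r c; rewrite [RHS]mxE /oct_clifford.
rewrite -[r]splitK -[c]splitK.
case: (split r) => r'; case: (split c) => c'; rewrite /= ?(ord1 r') ?(ord1 c').
- by rewrite block_mxEul mxE.
- by rewrite block_mxEur !mxE eqxx /= add0n eq_sym rmorphN /= mulrz_nat.
- by rewrite block_mxEdl !mxE eqxx /= add0n andbT mulrz_nat.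
- by rewrite block_mxEdr !mxE /= !add0n rmorphB /= !mulrz_nat.
Qed.

Lemma oct_cliffordP (a b : 'I_7) :
  oct_clifford R a *m oct_clifford R b + oct_clifford R b *m oct_clifford R a
  = (- (a == b)%:R *+ 2)%:M.
Proof.
pose prod a b r c := foldr (fun k z => clifford_entry a r k *
  clifford_entry b k c + z) 0 (iota 0 8).
have prodE (x y : 'I_7) (r c : 'I_(1 + 7)) :
    (oct_clifford R x *m oct_clifford R y) r c = (prod x y r c)%:~R.
  rewrite !oct_cliffordE mxE; under eq_bigr do rewrite !mxE -intrM.
  rewrite -rmorph_sum; congr (_%:~R).
  rewrite -(big_mkord xpredT (fun k => clifford_entry x r k *
    clifford_entry y k c)).
  by rewrite unlock.
have /allP comp : all (fun a => all (fun b => all (fun r => all (fun c =>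
    prod a b r c + prod b a r c == - ((a == b)%:R *+ 2 *+ (r == c)))
    (iota 0 8)) (iota 0 8)) (iota 0 7)) (iota 0 7) by vm_compute.
apply/matrixP => r c; rewrite [LHS]mxE !prodE -rmorphD /=.
have io n (i : 'I_n) : (i : nat) \in iota 0 n by rewrite mem_iota ltn_ord.
have /allP/(_ _ (io _ b))/allP/(_ _ (io _ r))/allP/(_ _ (io _ c))/eqP -> :=
  comp _ (io _ a).
by rewrite !mxE rmorphN !rmorphMn rmorph1 /= !mulNrn.
Qed.

Lemma mem_complexify N (g : {vspace 'M[R]_N}) (X : 'M[R[i]]_N) :
  X \in complexify g <->
  exists A B, [/\ A \in g, B \in g &
    X = map_mx (real_complex R) A + 'i%C *: map_mx (real_complex R) B].
Proof.
have mapg A : A \in g -> map_mx (real_complex R) A \in complexify g.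
  move=> /coord_vbasis ->; rewrite raddf_sum; apply: memv_suml => i _ /=.
  rewrite map_mxZ memvZ // memv_span //; apply: map_f.
  by rewrite mem_nth // size_tuple.
split=> [|[A [B [Ag Bg ->]]]]; last by rewrite memvD ?memvZ ?mapg.
move=> /(@coord_span _ _ _ (map_tuple (map_mx (real_complex R)) (vbasis g))) ->.
pose c i := coord (map_tuple (map_mx (real_complex R)) (vbasis g)) i X.
exists (\sum_i complex.Re (c i) *: (vbasis g)`_i),
  (\sum_i complex.Im (c i) *: (vbasis g)`_i).
have gi (i : 'I_(\dim g)) : (vbasis g)`_i \in g.
  by rewrite vbasis_mem // mem_nth // size_tuple.
split; [by apply: memv_suml => i _; apply/memvZ/gi..|].
rewrite !raddf_sum -big_split; apply: eq_bigr => i _ /=.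
rewrite (nth_map 0) ?size_tuple // !map_mxZ scalerA -scalerDl -/(c i).
by rewrite {1}[c i]complexE.
Qed.

End RealAlgebrasTheory.

Section ComplexTheory.
Variable C : fieldType.

Lemma bilin_trE (N : nat) (a b : 'cV[C]_N) : bilin a b = \tr (b *m a^T).
Proof. by apply: eq_bigr => i _; rewrite mxE big_ord1 !mxE mulrC. Qed.

Lemma lam2_form_wedge (N : nat) (a b : 'cV[C]_N) (X : 'M[C]_N) :
  2%:R != 0 :> C -> X^T = - X -> lam2_form X (wedge a b) = bilin (X *m a) b.
Proof.
move=> C2 skewX; rewrite /lam2_form /wedge mulmxBr raddfB /= bilin_trE.
have -> : \tr (X *m (b *m a^T)) = - \tr (X *m (a *m b^T)).
  rewrite -mxtrace_tr !trmx_mul trmxK skewX mulmxN raddfN /=.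
  by rewrite mxtrace_mulC.
rewrite -opprD -mulr2n mulrN opprK.
rewrite -[X in _ * X]mulr_natl mulKf //.
by rewrite -[RHS]mxtrace_tr trmx_mul trmxK mulmxA.
Qed.

Lemma lam2_form_gram (N : nat) (a b c d : 'cV[C]_N) :
  2%:R != 0 :> C ->
  lam2_form (wedge a b) (wedge c d) =
  bilin a c * bilin b d - bilin a d * bilin b c.
Proof.
move=> C2; rewrite lam2_form_wedge //; last first.
  by rewrite /wedge raddfB /= !trmx_mul !trmxK opprB.
have outer (x y z : 'cV[C]_N) : x *m y^T *m z = bilin y z *: x.
  apply/matrixP => i j; rewrite -mulmxA !mxE big_ord1 mulrC !ord1 mxE.
  by congr (_ * _); apply: eq_bigr => k _; rewrite mxE.
have bilinZD (x y z : 'cV[C]_N) (s t : C) :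
    bilin (s *: x - t *: y) z = s * bilin x z - t * bilin y z.
  rewrite /bilin !mulr_sumr -sumrB; apply: eq_bigr => k _.
  by rewrite !mxE mulrBl !mulrA.
by rewrite mulmxBl !outer bilinZD [bilin b c * _]mulrC.
Qed.

Lemma swap_mxE (N : nat) (a b : 'cV[C]_N) : swap_mx C N *m (a *t b) = b *t a.
Proof.
apply/matrixP => k l; rewrite mxE.
case: (mxtens_indexP k) => i j; rewrite (bigD1 (mxtens_index (j, i))) //=.
rewrite big1 ?addr0 => [|p]; last case: (mxtens_indexP p) => p1 p2 np.
  all: rewrite !mxE !mxtens_indexK /=.
  by rewrite eqxx mul1r mulrC; congr (_ * _); rewrite !ord1.
case: eqP => [[ip jp]|_]; last by rewrite mul0r.
by rewrite ip jp eqxx in np.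
Qed.

Lemma tau_opE (N m : nat) (a b : 'cV[C]_N) (v : 'cV[C]_m) :
  tau_op C N m *m (a *t b *t v) = b *t a *t v.
Proof. by rewrite tensmx_mul swap_mxE mul1mx. Qed.

Lemma K_opE (N m d : nat) (Xs : d.-tuple 'M[C]_N)
    (a b : 'cV[C]_N) (v : 'cV[C]_m) :
  K_op m Xs *m (a *t b *t v) =
  - \sum_(i < d) (tnth Xs i *m a) *t (tnth Xs i *m b) *t v.
Proof.
rewrite mulNmx mulmx_suml; congr (- _); apply: eq_bigr => i _.
by rewrite !tensmx_mul mul1mx.
Qed.

Lemma B_opE (N m d : nat) (rho : 'M[C]_N -> 'M[C]_m) (Xs : d.-tuple 'M[C]_N)
    (a b : 'cV[C]_N) (v : 'cV[C]_m) :
  B_op rho Xs *m (a *t b *t v) =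
  - \sum_(i < d) a *t (tnth Xs i *m b) *t (rho (tnth Xs i) *m v).
Proof.
rewrite mulNmx mulmx_suml; congr (- _); apply: eq_bigr => i _.
by rewrite !tensmx_mul mul1mx.
Qed.

End ComplexTheory.

(* Main.v *)
Require Import Defs.
From mathcomp Require Import all_boot all_order all_algebra.
From mathcomp Require Import reals.
From mathcomp Require Import ring.

Set Implicit Arguments.
Unset Strict Implicit.
Unset Printing Implicit Defensive.

Import Order.TTheory GRing.Theory Num.Theory.
Local Open Scope ring_scope.

(** The theorem comes from evaluating the Casimir operator of h on
    T (x) T (x) V in two ways.  An element X acts as X1 + X2 + X3, where the
    index says on which factor X acts.  The operators K, B and tau B tau are the
    sums over an orthonormal basis of h of - X1 X2, - X2 X3 and - X1 X3:
    conjugating by the flip moves the action on the second factor to the first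
    [tau_B_tau].  Therefore [tensor_action_casimir]

      sum (X1 + X2 + X3)^2 = Cas_1 + Cas_2 + Cas_3 - 2 (K + B + tau B tau).

    An equivariant F turns the left side into Cas_V o F.  If Cas_V and Cas_T are
    scalars, then Cas_3 contributes that same scalar, the two contributions of V
    cancel, and 2 Cas_T F - 2 F (K + B + tau B tau) = 0 is left
    [in_W_casimir].

    It remains to see that both Casimir operators are scalars.  They commute
    with g because h is an ideal and the form is invariant
    [casimir_in_commutes].  On V, which is irreducible over the complex
    numbers, Schur's lemma applies [schur_scalar].

    On T it does not: T is reducible for u(n), su(n) and sp(n), since the real
    representation has a complex structure.  What saves the claim is that h
    consists of skew matrices, so that Cas_T is symmetric as well.  A symmetric
    matrix S commuting with g is scalar as soon as, for every pair i, j of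
    distinct coordinates, g contains a skew X that preserves the coordinate
    plane spanned by e_i and e_j and acts on it as a nonzero multiple of a
    rotation [symmetric_commuting_scalar].  Each holonomy algebra contains all
    these matrices [holonomy_planes]:
    - for so(n), the rotations of coordinate planes themselves;
    - for u(n), su(n) and sp(n), Kronecker products of a matrix with at most two
      nonzero entries off the diagonal, or a diagonal one, with the identity or
      with a unit acting on C or H, and sp(1) + sp(n) contains those of sp(n);
    - for g2, differences of rotations in the planes of two Fano lines through
      one point;
    - for spin(7), products of two Clifford generators, which are signed
      permutation matrices of the octonion basis.

    The value of the scalar comes from its trace: every basis element
    satisfies tr (X X) = - 2 [casimir_trace]. *)

(** * Tensor products and the flip *)
Lemma tensmx_suml (A : pzRingType) (I : finType) m n p q
    (X : I -> 'M[A]_(m, n)) (Z : 'M[A]_(p, q)) :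
  (\sum_i X i) *t Z = \sum_i X i *t Z.
Proof.
apply/matrixP => i j; rewrite summxE mxE summxE mulr_suml.
by apply: eq_bigr => k _; rewrite mxE.
Qed.

Lemma tensmx_sumr (A : pzRingType) (I : finType) m n p q
    (Z : 'M[A]_(m, n)) (X : I -> 'M[A]_(p, q)) :
  Z *t (\sum_i X i) = \sum_i Z *t X i.
Proof.
apply/matrixP => i j; rewrite summxE mxE summxE mulr_sumr.
by apply: eq_bigr => k _; rewrite mxE.
Qed.

Lemma tens_scalar_scalar (A : pzRingType) m n (a b : A) :
  a%:M *t b%:M = (a * b)%:M :> 'M_(m * n).
Proof.
apply/matrixP => k l; case: (mxtens_indexP k) => i j.
case: (mxtens_indexP l) => i' j'; rewrite tensmxE !mxE.
rewrite (can_eq (@mxtens_indexK m n)) xpair_eqE mulrnAl mulrnAr -mulrnA mulnb.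
by rewrite andbC.
Qed.

Lemma swap_mx_tens (C : fieldType) N (X Y : 'M[C]_N) :
  swap_mx C N *m (X *t Y) = (Y *t X) *m swap_mx C N.
Proof.
apply/matrixP => k l; case: (mxtens_indexP k) => i j.
case: (mxtens_indexP l) => i' j'; rewrite !mxE.
rewrite (bigD1 (mxtens_index (j, i))) //=.
rewrite [RHS](bigD1 (mxtens_index (j', i'))) //=.
rewrite ![\sum_(_ | _ != _) _]big1 => [|p|p]; last 2 first.
- case: (mxtens_indexP p) => p1 p2 np; rewrite !mxE !mxtens_indexK /=.
  case: eqP => [e|_]; last by rewrite mulr0.
  by case: e np => -> ->; rewrite eqxx.
- case: (mxtens_indexP p) => p1 p2 np; rewrite !mxE !mxtens_indexK /=.
  case: eqP => [e|_]; last by rewrite mul0r.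
  by case: e np => -> ->; rewrite eqxx.
by rewrite !addr0 !mxE !mxtens_indexK /= !eqxx mul1r mulr1 mulrC.
Qed.

Lemma swap_mxK (C : fieldType) N : swap_mx C N *m swap_mx C N = 1%:M.
Proof.
apply/matrixP => k l; case: (mxtens_indexP k) => i j.
case: (mxtens_indexP l) => i' j'.
rewrite !mxE (bigD1 (mxtens_index (j, i))) //= big1 => [|p].
  rewrite !mxE !mxtens_indexK /= eqxx mul1r addr0.
  by rewrite (can_eq (@mxtens_indexK N N)) !xpair_eqE andbC.
case: (mxtens_indexP p) => p1 p2 np; rewrite !mxE !mxtens_indexK /=.
case: eqP => [e|_]; last by rewrite mul0r.
by case: e np => -> ->; rewrite eqxx.
Qed.

(** * The Casimir operator of an ideal *)
Section Casimir.
Variables (C : fieldType) (N : nat).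
Implicit Types (g h : {vspace 'M[C]_N}) (X Y Z : 'M[C]_N).

Lemma lam2_form_suml (I : finType) (c : I -> C) (Y : I -> 'M[C]_N) Z :
  lam2_form (\sum_i c i *: Y i) Z = \sum_i c i * lam2_form (Y i) Z.
Proof.
rewrite /lam2_form mulmx_suml raddf_sum mulr_sumr -sumrN; apply: eq_bigr.
by move=> i _; rewrite -scalemxAl /= mxtraceZ; ring.
Qed.

(** Invariance of the form under ad X: the matrix of ad X in an orthonormal
    basis is skew. *)
Lemma lam2_form_bracket X Y Z :
  lam2_form (lie_bracket X Y) Z = - lam2_form (lie_bracket X Z) Y.
Proof.
rewrite /lam2_form /lie_bracket !mulmxBl !raddfB /=.
rewrite (mxtrace_mulC (X *m Z)) (mxtrace_mulC (Z *m X)) !mulmxA.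
rewrite (mxtrace_mulC (Y *m Z)) mulmxA.
ring.
Qed.

Lemma orthonormal_expansion d h (Xs : d.-tuple 'M[C]_N) Y :
  orthonormal_basis h Xs -> Y \in h ->
  Y = \sum_i lam2_form Y (tnth Xs i) *: tnth Xs i.
Proof.
move=> [bas orth] Yh.
have YE : Y = \sum_i coord Xs i Y *: tnth Xs i.
  rewrite {1}(coord_basis bas Yh); apply: eq_bigr => i _.
  by rewrite (tnth_nth 0).
rewrite {1}YE; apply: eq_bigr => i _; congr (_ *: _).
rewrite [in RHS]YE lam2_form_suml (bigD1 i) //= orth eqxx mulr1 big1 ?addr0 //.
by move=> j /negPf ji; rewrite orth ji mulr0.
Qed.

Lemma orthonormal_mem d h (Xs : d.-tuple 'M[C]_N) i :
  orthonormal_basis h Xs -> tnth Xs i \in h.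
Proof. by move=> [bas _]; apply: (basis_mem bas); apply: mem_tnth. Qed.

(** [rho] is an arbitrary function outside [g], so that its linearity is
    available only for combinations of elements of [g]. *)
Lemma representation_sum m g (rho : 'M[C]_N -> 'M[C]_m) (I : finType)
    (c : I -> C) (Y : I -> 'M[C]_N) :
  is_representation g rho -> (forall i, Y i \in g) ->
  rho (\sum_i c i *: Y i) = \sum_i c i *: rho (Y i).
Proof.
move=> [lin _] Yg.
have rho0 : rho 0 = 0.
  have := lin 1 0 0 (mem0v g) (mem0v g).
  by rewrite !scale1r addr0 -[LHS]addr0 => /addrI.
pose P A B := A \in g /\ rho A = B.
suff [] : P (\sum_i c i *: Y i) (\sum_i c i *: rho (Y i)) by [].
apply: (big_ind2 P) => [|A A' B B' [Ag <-] [Bg <-]|i _].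
- by split; [exact: mem0v|].
- by split; [exact: memvD|rewrite -{1}(scale1r A) lin // scale1r].
split; first exact: memvZ.
by rewrite -[c i *: Y i]addr0 lin ?mem0v // rho0 addr0.
Qed.

Lemma identity_representation g : is_representation g (fun X => X).
Proof. by []. Qed.

Definition casimir_in m (rho : 'M[C]_N -> 'M[C]_m) d
    (Xs : d.-tuple 'M[C]_N) : 'M[C]_m :=
  \sum_i rho (tnth Xs i) *m rho (tnth Xs i).

(** With [X, X_i] = sum_j a_ij X_j and a skew, the commutator of X with
    sum_i X_i X_i is sum_ij a_ij (X_j X_i + X_i X_j), a skew matrix paired with
    a symmetric one. *)
Lemma casimir_in_commutes m g h (rho : 'M[C]_N -> 'M[C]_m) d
    (Xs : d.-tuple 'M[C]_N) X :
  is_representation g rho -> is_ideal g h -> orthonormal_basis h Xs ->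
  X \in g -> rho X *m casimir_in rho Xs = casimir_in rho Xs *m rho X.
Proof.
move=> rep [hg idl] onb Xg.
have Xsh i := orthonormal_mem i onb.
have Xsg i : tnth Xs i \in g by exact: (subvP hg).
pose a i j := lam2_form (lie_bracket X (tnth Xs i)) (tnth Xs j).
have ad i : lie_bracket (rho X) (rho (tnth Xs i)) =
    \sum_j a i j *: rho (tnth Xs j).
  rewrite -(representation_sum (a i) rep Xsg) -(proj2 rep) //; congr (rho _).
  exact: (orthonormal_expansion onb (idl _ _ Xg (Xsh i))).
apply/eqP; rewrite -subr_eq0; apply/eqP.
pose r i := rho (tnth Xs i).
transitivity (\sum_i \sum_j a i j *: (r j *m r i) +
              \sum_i \sum_j a i j *: (r i *m r j)).
  rewrite -big_split /casimir_in mulmx_sumr mulmx_suml -sumrB.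
  apply: eq_bigr => i _ /=.
  transitivity (lie_bracket (rho X) (r i) *m r i
                + r i *m lie_bracket (rho X) (r i)).
    by rewrite /lie_bracket mulmxBl mulmxBr !mulmxA addrA subrK.
  rewrite !ad mulmx_suml mulmx_sumr; congr (_ + _); apply: eq_bigr => j _.
    by rewrite -scalemxAl.
  by rewrite -scalemxAr.
(* Once i and j are exchanged in the first sum, the two sums have opposite
   coefficients. *)
rewrite exchange_big -big_split big1 //= => i _.
rewrite -big_split big1 //= => j _.
by rewrite /a lam2_form_bracket scaleNr addNr.
Qed.

(** Each basis element has - tr (X X) / 2 = 1. *)
Lemma casimir_trace d h (Xs : d.-tuple 'M[C]_N) :
  2%:R != 0 :> C -> orthonormal_basis h Xs ->
  \tr (casimir Xs) = - (2%:R * d%:R).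
Proof.
move=> C2 [_ orth]; rewrite raddf_sum /= (eq_bigr (fun=> - 2%:R)) => [|i _].
  by rewrite sumr_const card_ord mulNrn mulr_natr.
have := orth i i; rewrite eqxx /lam2_form => /(congr1 (fun x => - 2%:R * x)).
by rewrite mulrNN mulVKf // mulr1.
Qed.

Lemma casimir_sym d (Xs : d.-tuple 'M[C]_N) :
  (forall i, (tnth Xs i)^T = - tnth Xs i) -> (casimir Xs)^T = casimir Xs.
Proof.
move=> sk; rewrite raddf_sum; apply: eq_bigr => i _ /=.
by rewrite trmx_mul sk mulmxN mulNmx opprK.
Qed.

Section Tensor.
Variables (m : nat) (rho : 'M[C]_N -> 'M[C]_m).
Variables (d : nat) (Xs : d.-tuple 'M[C]_N).

(** The flip carries the action on the second factor to the first, so that the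
    three operators run over the three pairs of factors. *)
Lemma tau_B_tau : tau_op C N m *m B_op rho Xs *m tau_op C N m =
  - \sum_i tnth Xs i *t 1%:M *t rho (tnth Xs i).
Proof.
rewrite /B_op mulmxN mulNmx mulmx_sumr mulmx_suml; congr (- _).
apply: eq_bigr => i _.
by rewrite !tensmx_mul mul1mx mulmx1 swap_mx_tens -mulmxA swap_mxK mulmx1.
Qed.

Lemma tensor_action_sqr X :
  tensor_action rho X *m tensor_action rho X =
  (X *m X) *t 1%:M *t 1%:M + 1%:M *t (X *m X) *t 1%:M
  + 1%:M *t 1%:M *t (rho X *m rho X)
  + (X *t X *t 1%:M + 1%:M *t X *t rho X + X *t 1%:M *t rho X) *+ 2.
Proof.
rewrite /tensor_action !(mulmxDl, mulmxDr) !tensmx_mul !(mul1mx, mulmx1).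
rewrite mulr2n.
move: (X *m X *t _ *t _) (_ *t (X *m X) *t _) (_ *t (rho X *m rho X)).
move: (X *t X *t _) (_ *t X *t rho X) (X *t _ *t rho X) => p q r a b c.
by apply/matrixP => i j; rewrite !mxE; ring.
Qed.

(** Squares give the Casimir operators of the factors, cross terms give the
    three operators of the theorem with the sign from their definition. *)
Lemma tensor_action_casimir :
  \sum_i tensor_action rho (tnth Xs i) *m tensor_action rho (tnth Xs i) =
  casimir Xs *t 1%:M *t 1%:M + 1%:M *t casimir Xs *t 1%:M
  + 1%:M *t 1%:M *t casimir_in rho Xs
  - (K_op m Xs + B_op rho Xs
     + tau_op C N m *m B_op rho Xs *m tau_op C N m) *+ 2.
Proof.
rewrite tau_B_tau /K_op /B_op -!opprD mulNrn opprK -!big_split /= -sumrMnl.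
rewrite /casimir tensmx_sumr !tensmx_suml /casimir_in tensmx_sumr -!big_split.
by apply: eq_bigr => i _; rewrite tensor_action_sqr.
Qed.

(** Equivariance, used twice, moves X^2 through F, and the two terms
    [cV *: F] cancel. *)
Lemma in_W_casimir g (F : 'M[C]_(m, N * N * m)) (cT cV : C) :
  2%:R != 0 :> C ->
  (forall i, tnth Xs i \in g) -> in_W g rho F ->
  casimir Xs = cT%:M -> casimir_in rho Xs = cV%:M ->
  F *m (K_op m Xs + B_op rho Xs
        + tau_op C N m *m B_op rho Xs *m tau_op C N m) = cT *: F.
Proof.
move=> C2 Xg FW casT casV.
have : F *m (\sum_i tensor_action rho (tnth Xs i)
    *m tensor_action rho (tnth Xs i)) = casimir_in rho Xs *m F.
  rewrite mulmx_sumr mulmx_suml; apply: eq_bigr => i _.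
  by rewrite mulmxA FW // -mulmxA FW // mulmxA.
rewrite tensor_action_casimir casT casV !tens_scalar_scalar !mulr1 !mul1r.
set S := K_op _ _ + _ + _.
rewrite mulmxBr !mulmxDr !mul_mx_scalar mul_scalar_mx.
move=> /eqP; rewrite addrAC -subr_eq0 addrK subr_eq0.
by rewrite -!mulr2n -!scaler_nat => /eqP /(scalerI C2).
Qed.

End Tensor.
End Casimir.

(** A nonzero eigenspace of [M] is invariant, hence everything. *)
Lemma schur_scalar (C : numClosedFieldType) N m (g : {vspace 'M[C]_N})
    (rho : 'M[C]_N -> 'M[C]_m) (M : 'M[C]_m) :
  is_irreducible g rho ->
  (forall X, X \in g -> rho X *m M = M *m rho X) -> exists c, M = c%:M.
Proof.
(* [eigenvalueP] is about row vectors, hence the transpose. *)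
move=> [m_gt0 irr] comm; have [c] := eigenvalue_closed (M^T) m_gt0.
move=> /eigenvalueP [v vM v0]; exists c.
pose U := lker (linfun (mulmx (M - c%:M) : 'cV[C]_m -> 'cV[C]_m)).
have UE u : (u \in U) = (M *m u == c *: u).
  by rewrite memv_ker lfunE /= mulmxBl mul_scalar_mx subr_eq0.
case: (irr U) => [X u Xg|U0|UT].
- by rewrite !UE => /eqP Mu; rewrite mulmxA -comm // -mulmxA Mu -scalemxAr.
- have : v^T \in U by rewrite UE -[M]trmxK -trmx_mul vM linearZ.
  by rewrite U0 memv0 -trmx0 (inj_eq trmx_inj) (negPf v0).
apply/matrixP => i j.
have : delta_mx j 0 \in U by rewrite UT memvf.
rewrite UE => /eqP /matrixP /(_ i 0); rewrite -colE !mxE => ->.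
by rewrite andbT mulr_natr.
Qed.

(** * Symmetric matrices commuting with plane rotations *)

(** For a skew matrix the vanishing of these row entries is also that of the
    corresponding columns: [X] maps the span of e_i and e_j to itself, and its
    restriction is a nonzero multiple of a rotation when i and j differ.  The
    case i = j is needed for the factors of a Kronecker product. *)
Definition plane_preserving (F : fieldType) n (X : 'M[F]_n) (i j : 'I_n) :=
  [/\ X i j != 0, forall k, k != j -> X i k = 0
    & forall k, k != i -> X j k = 0].

(** Compare the entries (i, i) and (i, j) of S X and X S: the first gives
    2 X_ij S_ij = 0, the second X_ij S_ii = X_ij S_jj, because X_ij and
    X_ji = - X_ij are the only nonzero entries of X in the rows and columns i
    and j. *)
Lemma symmetric_commuting_plane (F : fieldType) n (S X : 'M[F]_n) i j :
  2%:R != 0 :> F -> S^T = S -> X^T = - X -> plane_preserving X i j ->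
  S *m X = X *m S -> S i j = 0 /\ S i i = S j j.
Proof.
move=> F2 /matrixP symS /matrixP skX [Xij Xi Xj] /matrixP comm.
have S_ji a b : S b a = S a b by have := symS a b; rewrite mxE.
have X_ji a b : X b a = - X a b by have := skX a b; rewrite !mxE.
have row_i u : (X *m S) i u = X i j * S j u.
  rewrite mxE (bigD1 j) //= big1 ?addr0 // => k kj.
  by rewrite Xi ?mul0r.
have col_i u : (S *m X) u i = - (X i j * S u j).
  rewrite mxE (bigD1 j) //= big1 ?addr0 => [|k kj]; first by rewrite X_ji; ring.
  by rewrite X_ji Xi ?oppr0 ?mulr0.
have col_j u : (S *m X) u j = X i j * S u i.
  rewrite mxE (bigD1 i) //= big1 ?addr0 => [|k ki]; first by rewrite mulrC.
  by rewrite X_ji Xj ?oppr0 ?mulr0.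
split.
  apply: (mulfI Xij); apply: (mulfI F2); have := comm i i.
  rewrite row_i col_i S_ji => /eqP; rewrite -subr_eq0 => /eqP h.
  by rewrite !mulr0 -[RHS]oppr0 -h; ring.
by apply: (mulfI Xij); rewrite -row_i -col_j comm.
Qed.

Lemma symmetric_commuting_scalar (F : fieldType) n (S : 'M[F]_n) :
  2%:R != 0 :> F -> S^T = S ->
  (forall i j, i != j -> exists X,
     [/\ X^T = - X, plane_preserving X i j & S *m X = X *m S]) ->
  exists c, S = c%:M.
Proof.
case: n S => [|n] S F2 symS planes; first by exists 0; apply/matrixP; case.
exists (S 0 0); apply/matrixP => i j; rewrite mxE.
have [<-{j}|ij] := eqVneq i j.
  have [->//|i0] := eqVneq i 0.
  have [X [? ? ?]] := planes _ _ i0.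
  by case: (@symmetric_commuting_plane _ _ S X i 0).
have [X [? ? ?]] := planes _ _ ij.
by case: (@symmetric_commuting_plane _ _ S X i j).
Qed.

Lemma mem_sum_lines (F : fieldType) (vT : vectType F) (I J : finType)
    (P : I -> pred J) (u : I -> J -> vT) i j :
  P i j -> u i j \in (\sum_i \sum_(j | P i j) <[u i j]>)%VS.
Proof.
move=> Pij; rewrite memvE; apply: (sumv_sup i) => //; exact: (sumv_sup j).
Qed.

(** * Plane-preserving elements of the classical algebras *)
Section Planes.
Variable R : realType.

Lemma plane_preserving_tens n k (A : 'M[R]_n) (Q : 'M[R]_k) p q a b :
  plane_preserving A p q -> plane_preserving Q a b ->
  plane_preserving (A *t Q) (mxtens_index (p, a)) (mxtens_index (q, b)).
Proof.
move=> [Apq Ap Aq] [Qab Qa Qb]; split=> [|l|l].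
  by rewrite tensmxE mulf_neq0.
  case: (mxtens_indexP l) => r c; rewrite (can_eq (@mxtens_indexK _ _)).
  by rewrite xpair_eqE negb_and tensmxE => /orP[/Ap|/Qa] ->;
    rewrite ?mul0r ?mulr0.
case: (mxtens_indexP l) => r c; rewrite (can_eq (@mxtens_indexK _ _)).
by rewrite xpair_eqE negb_and tensmxE => /orP[/Aq|/Qb] ->;
  rewrite ?mul0r ?mulr0.
Qed.

Lemma plane_preserving1 k (a : 'I_k) : plane_preserving (1%:M : 'M[R]_k) a a.
Proof.
by split=> [|b ba|b ba]; rewrite mxE ?eqxx ?oner_eq0 // eq_sym (negPf ba).
Qed.

Definition skew_unit n (p q : 'I_n) : 'M[R]_n := delta_mx p q - delta_mx q p.
Definition sym_unit n (p q : 'I_n) : 'M[R]_n := delta_mx p q + delta_mx q p.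

Lemma trmx_skew_unit n (p q : 'I_n) : (skew_unit p q)^T = - skew_unit p q.
Proof. by rewrite linearB /= !trmx_delta opprB. Qed.

Lemma trmx_sym_unit n (p q : 'I_n) : (sym_unit p q)^T = sym_unit p q.
Proof. by rewrite linearD /= !trmx_delta addrC. Qed.

Lemma plane_preserving_skew_unit n (p q : 'I_n) :
  p != q -> plane_preserving (skew_unit p q) p q.
Proof.
move=> pq; split=> [|k /negPf kq|k /negPf kp]; rewrite !mxE !eqxx /=.
- by rewrite (negPf pq) subr0 oner_eq0.
- by rewrite kq (negPf pq) subr0.
by rewrite kp eq_sym (negPf pq) subr0.
Qed.

(** This includes p = q, where the matrix is twice a diagonal unit. *)
Lemma plane_preserving_sym_unit n (p q : 'I_n) :
  plane_preserving (sym_unit p q) p q.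
Proof.
split=> [|k /negPf kq|k /negPf kp]; rewrite !mxE !eqxx /=.
- by rewrite -natrD pnatr_eq0 addn_eq0.
- by rewrite kq add0r; case: eqP => [->|_]; rewrite ?kq.
by rewrite kp addr0 andbC; case: eqP => [<-|_]; rewrite ?kp.
Qed.

(** The traceless replacement for [sym_unit p p], which su(n) requires. *)
Lemma plane_preserving_diag n (p r : 'I_n) : p != r ->
  plane_preserving (sym_unit p p - sym_unit r r) p p.
Proof.
move=> /negPf pr; split=> [|k /negPf kp|k /negPf kp];
  rewrite !mxE ?eqxx ?kp pr /=.
- by rewrite addr0 subr0 -natrD pnatr_eq0.
- by rewrite !addr0 subr0.
by rewrite !addr0 subr0.
Qed.

(** Below, a matrix given by explicit integer entries is an [int_mx], so that
    identities between such matrices are decided by computing with [int]. *)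
Definition int_mx n (f : nat -> nat -> int) : 'M[R]_n :=
  \matrix_(r < n, c < n) (f r c)%:~R.

Definition int_sum n (h : nat -> int) : int :=
  foldr (fun k z => h k + z) 0 (iota 0 n).

Definition int_mul n (f g : nat -> nat -> int) (r c : nat) : int :=
  int_sum n (fun k => f r k * g k c).

Definition all_below n (P : pred nat) : bool := all P (iota 0 n).

Lemma all_belowP n (P : pred nat) : all_below n P -> forall i : 'I_n, P i.
Proof. by move=> /allP Pn i; apply: Pn; rewrite mem_iota ltn_ord. Qed.

Lemma has_belowP n (P : pred nat) :
  has P (iota 0 n) -> exists i : 'I_n, P i.
Proof.
case/hasP => i; rewrite mem_iota /= add0n => lt_i Pi.
by exists (Ordinal lt_i).
Qed.

Lemma int_sumE n (h : nat -> int) :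
  \sum_(k < n) (h k)%:~R = (int_sum n h)%:~R :> R.
Proof.
rewrite -rmorph_sum; congr (_%:~R).
by rewrite -(big_mkord xpredT h) unlock /index_iota subn0.
Qed.

Lemma int_mx_mul n f g : int_mx n f *m int_mx n g = int_mx n (int_mul n f g).
Proof.
apply/matrixP => r c; rewrite !mxE -int_sumE; apply: eq_bigr => k _.
by rewrite !mxE intrM.
Qed.

Lemma int_mx_eq n f g :
  all_below n (fun r => all_below n (fun c => f r c == g r c)) ->
  int_mx n f = int_mx n g.
Proof.
move=> fg; apply/matrixP => r c; rewrite !mxE.
by have /all_belowP/(_ c)/eqP-> := all_belowP fg r.
Qed.

Lemma int_mx_skew n f :
  all_below n (fun r => all_below n (fun c => f c r == - f r c)) ->
  (int_mx n f)^T = - int_mx n f.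
Proof.
move=> fN; apply/matrixP => r c; rewrite !mxE.
by have /all_belowP/(_ c)/eqP-> := all_belowP fN r; rewrite rmorphN.
Qed.

Definition int_plane_preserving n (f : nat -> nat -> int) (i j : nat) : bool :=
  [&& f i j != 0, all_below n (fun k => (k != j) ==> (f i k == 0))
    & all_below n (fun k => (k != i) ==> (f j k == 0))].

Lemma int_mx_plane_preserving n f (i j : 'I_n) :
  int_plane_preserving n f i j -> plane_preserving (int_mx n f) i j.
Proof.
move=> /and3P[fij fi fj]; split=> [|k kj|k ki]; rewrite mxE ?intr_eq0 //.
  by have := all_belowP fi k; rewrite kj => /eqP->.
by have := all_belowP fj k; rewrite ki => /eqP->.
Qed.

Definition has_planes n (g : {vspace 'M[R]_n}) : Prop :=
  forall i j : 'I_n, i != j -> exists2 X, X \in g & plane_preserving X i j.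

Lemma has_planes_sub n (g g' : {vspace 'M[R]_n}) :
  (g <= g')%VS -> has_planes g -> has_planes g'.
Proof.
by move=> /subvP gg' pg i j /pg[X Xg Xij]; exists X => //; apply: gg'.
Qed.

Lemma so_planes n : has_planes (so_alg R n).
Proof.
move=> i j ij; exists (skew_unit i j); last exact: plane_preserving_skew_unit.
by rewrite mem_so_alg trmx_skew_unit.
Qed.

Definition row_entry (s : seq (seq int)) (r c : nat) : int :=
  nth 0 (nth [::] s r) c.

Lemma mx_of_rowsE n s : mx_of_rows R n s = int_mx n (row_entry s).
Proof. by []. Qed.

Lemma trmx_mul_i : (mul_i R)^T = - mul_i R.
Proof. by rewrite /mul_i mx_of_rowsE; apply: int_mx_skew; vm_compute. Qed.

Lemma mul_i_planes (a b : 'I_2) : a != b -> plane_preserving (mul_i R) a b.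
Proof.
move=> ab; rewrite /mul_i mx_of_rowsE; apply: int_mx_plane_preserving.
have comp : all_below 2 (fun a => all_below 2 (fun b => (a != b) ==>
  int_plane_preserving 2 (row_entry [:: [:: 0; -1]; [:: 1; 0]]) a b))
  by vm_compute.
by have := all_belowP (all_belowP comp a) b; rewrite ab.
Qed.

Lemma mxtrace_tens n k (A : 'M[R]_n) (Q : 'M[R]_k) :
  \tr (A *t Q) = \tr A * \tr Q.
Proof. by rewrite /mxtrace mulr_sum; apply: eq_bigr => i _; rewrite mxE. Qed.

(** These are the matrices of so(n), extended complex linearly. *)
Lemma tens_skew_in_su n (A : 'M[R]_n) :
  A^T = - A -> A *t 1%:M \in su_alg R n.
Proof.
move=> skA; have tr0 : \tr A = 0.
  have : \tr A *+ 2 = 0 by rewrite mulr2n -{1}mxtrace_tr skA raddfN addNr.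
  by move=> /eqP; rewrite mulrn_eq0 => /eqP.
rewrite mem_su_alg mem_u_alg /complex_structure !tensmx_mul.
rewrite trmx_tens skA trmx1 !mul1mx !mulmx1 mxtrace_tens tr0 mul0r !eqxx !andbT.
by apply/eqP/matrixP => r c; rewrite !mxE mulNr.
Qed.

(** These are i times the real symmetric matrices. *)
Lemma tens_mul_i_in_u n (A : 'M[R]_n) : A^T = A -> A *t mul_i R \in u_alg R n.
Proof.
move=> symA; rewrite mem_u_alg /complex_structure !tensmx_mul trmx_tens symA.
rewrite trmx_mul_i !mul1mx !mulmx1 eqxx andbT.
by apply/eqP/matrixP => r c; rewrite !mxE mulrN.
Qed.

Lemma tens_mul_i_in_su n (A : 'M[R]_n) :
  A^T = A -> \tr A = 0 -> A *t mul_i R \in su_alg R n.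
Proof.
move=> symA trA; rewrite mem_su_alg tens_mul_i_in_u //.
by rewrite /complex_structure tensmx_mul mul1mx mxtrace_tens trA mul0r eqxx.
Qed.

Lemma su_sub_u n : (su_alg R n <= u_alg R n)%VS.
Proof. exact: capvSl. Qed.

(** Coordinates are pairs (p, a) with a in {1, i}.  Pairs with the same second
    component need a real rotation, the others i times a real symmetric
    matrix. *)
Lemma u_planes n : has_planes (u_alg R n).
Proof.
move=> i j; case: (mxtens_indexP i) => p a; case: (mxtens_indexP j) => q b.
rewrite (can_eq (@mxtens_indexK _ _)) xpair_eqE negb_and.
have [<-{b}|ab _] := eqVneq a b.
  rewrite orbF => pq; exists (skew_unit p q *t 1%:M).
    by apply/(subvP (su_sub_u n))/tens_skew_in_su/trmx_skew_unit.
  apply: plane_preserving_tens; last exact: plane_preserving1.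
  exact: plane_preserving_skew_unit.
exists (sym_unit p q *t mul_i R); first exact/tens_mul_i_in_u/trmx_sym_unit.
apply: plane_preserving_tens; last exact: mul_i_planes.
exact: plane_preserving_sym_unit.
Qed.

Lemma tr_sym_unit n (p q : 'I_n) : \tr (sym_unit p q) = (p == q)%:R *+ 2.
Proof.
have tr_delta (r s : 'I_n) : \tr (delta_mx r s : 'M[R]_n) = (r == s)%:R.
  rewrite /mxtrace (bigD1 r) //= mxE eqxx /= big1 ?addr0 // => k /negPf kr.
  by rewrite mxE kr.
by rewrite raddfD /= !tr_delta [q == p]eq_sym mulr2n.
Qed.

(** As for u(n), but the plane of (p, 1) and (p, i) needs a diagonal matrix of
    trace zero, whence a second index r. *)
Lemma su_planes n : (2 <= n)%N -> has_planes (su_alg R n).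
Proof.
move=> n2 i j; case: (mxtens_indexP i) => p a; case: (mxtens_indexP j) => q b.
rewrite (can_eq (@mxtens_indexK _ _)) xpair_eqE negb_and.
have [<-{b}|ab _] := eqVneq a b.
  rewrite orbF => pq; exists (skew_unit p q *t 1%:M).
    exact/tens_skew_in_su/trmx_skew_unit.
  apply: plane_preserving_tens; last exact: plane_preserving1.
  exact: plane_preserving_skew_unit.
have [<-{q}|pq] := eqVneq p q; last first.
  exists (sym_unit p q *t mul_i R).
    apply: tens_mul_i_in_su; first exact: trmx_sym_unit.
    by rewrite tr_sym_unit (negPf pq) mul0rn.
  apply: plane_preserving_tens; last exact: mul_i_planes.
  exact: plane_preserving_sym_unit.
have [r pr] : exists r, p != r.
  have : (0 < #|predC1 p|)%N by rewrite cardC1 card_ord -subn1 subn_gt0.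
  by case/card_gt0P => r; rewrite inE eq_sym; exists r.
exists ((sym_unit p p - sym_unit r r) *t mul_i R).
  apply: tens_mul_i_in_su; first by rewrite linearB /= !trmx_sym_unit.
  by rewrite raddfB /= !tr_sym_unit !eqxx subrr.
apply: plane_preserving_tens; last exact: mul_i_planes.
exact: plane_preserving_diag.
Qed.

(** Left multiplications by i, j and k in the basis (1, i, j, k). *)
Definition lmul_rows : seq (seq (seq int)) :=
  [:: [:: [:: 0; -1; 0; 0];
          [:: 1; 0; 0; 0];
          [:: 0; 0; 0; -1];
          [:: 0; 0; 1; 0]];
      [:: [:: 0; 0; -1; 0];
          [:: 0; 0; 0; 1];
          [:: 1; 0; 0; 0];
          [:: 0; -1; 0; 0]];
      [:: [:: 0; 0; 0; -1];
          [:: 0; 0; -1; 0];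
          [:: 0; 1; 0; 0];
          [:: 1; 0; 0; 0]]].

Definition lmul_entry (q : nat) : nat -> nat -> int :=
  row_entry (nth [::] lmul_rows q).

Definition lmul (q : nat) : 'M[R]_4 := int_mx 4 (lmul_entry q).

Lemma trmx_lmul (q : 'I_3) : (lmul q)^T = - lmul q.
Proof.
apply: int_mx_skew.
have comp : all_below 3 (fun q => all_below 4 (fun r => all_below 4 (fun c =>
  lmul_entry q c r == - lmul_entry q r c))) by vm_compute.
exact: all_belowP comp q.
Qed.

(** For two basis quaternions a, b, one of i, j, k maps a to b up to sign. *)
Lemma lmul_planes (a b : 'I_4) : a != b ->
  exists q : 'I_3, plane_preserving (lmul q) a b.
Proof.
move=> ab.
have comp : all_below 4 (fun a => all_below 4 (fun b => (a != b) ==>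
  has (fun q => int_plane_preserving 4 (lmul_entry q) a b) (iota 0 3)))
  by vm_compute.
have := all_belowP (all_belowP comp a) b; rewrite ab => /has_belowP[q].
by exists q; apply: int_mx_plane_preserving.
Qed.

Lemma lmul_rmul (q : 'I_3) : [/\ rmul_i R *m lmul q = lmul q *m rmul_i R,
  rmul_j R *m lmul q = lmul q *m rmul_j R
  & rmul_k R *m lmul q = lmul q *m rmul_k R].
Proof.
by split; rewrite /rmul_i /rmul_j /rmul_k !mx_of_rowsE !int_mx_mul;
  apply: int_mx_eq; case: q => [[|[|[|]]]] //= _; vm_compute.
Qed.

Lemma tens_in_sp n (A : 'M[R]_n) (Q : 'M[R]_4) :
  (A *t Q)^T = - (A *t Q) ->
  rmul_i R *m Q = Q *m rmul_i R -> rmul_j R *m Q = Q *m rmul_j R ->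
  rmul_k R *m Q = Q *m rmul_k R -> A *t Q \in sp_alg R n.
Proof.
move=> skew Qi Qj Qk; rewrite mem_sp_alg skew eqxx /=.
by rewrite !tensmx_mul !mul1mx !mulmx1 Qi Qj Qk !eqxx.
Qed.

(** As for u(n), with left multiplications in the role of i: they commute with
    the right ones, which define the quaternionic structure. *)
Lemma sp_planes n : has_planes (sp_alg R n).
Proof.
move=> i j; case: (mxtens_indexP i) => p a; case: (mxtens_indexP j) => q b.
rewrite (can_eq (@mxtens_indexK _ _)) xpair_eqE negb_and.
have [<-{b}|ab _] := eqVneq a b.
  rewrite orbF => pq; exists (skew_unit p q *t 1%:M).
    apply: tens_in_sp; rewrite ?mul1mx ?mulmx1 //.
    rewrite trmx_tens trmx_skew_unit trmx1.
    by apply/matrixP => r c; rewrite !mxE mulNr.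
  apply: plane_preserving_tens; last exact: plane_preserving1.
  exact: plane_preserving_skew_unit.
have [l l_ab] := lmul_planes ab; have [li lj lk] := lmul_rmul l.
exists (sym_unit p q *t lmul l).
  apply: tens_in_sp => //; rewrite trmx_tens trmx_sym_unit trmx_lmul.
  by apply/matrixP => r c; rewrite !mxE mulrN.
by apply: plane_preserving_tens => //; apply: plane_preserving_sym_unit.
Qed.

Lemma sp1_sp_planes n : has_planes (sp1_sp_alg R n).
Proof. exact: has_planes_sub (addvSr _ _) (@sp_planes n). Qed.

(** * Plane-preserving elements of the exceptional algebras *)

Definition oct_entry (a b c : nat) : int := (fano a b c)%:R - (fano b a c)%:R.

(** The Fano lines through a are {a, a + t, a + 3 t} for t = 1, 2, 4, because
    multiplication by 2 modulo 7 permutes the lines.  This is the rotation in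
    the plane of the two points other than a. *)
Definition oct_plane (a t r c : nat) : int :=
  ((r == (a + 3 * t) %% 7)%N && (c == (a + t) %% 7)%N)%:R -
  ((r == (a + t) %% 7)%N && (c == (a + 3 * t) %% 7)%N)%:R.

(** The stabilizer of e_a in g2 is su(3), acting on the three planes as complex
    lines; the difference of two rotations lies in its maximal torus. *)
Definition g2_entry (a t r c : nat) : int :=
  oct_plane a t r c - oct_plane a (2 * t) r c.

Definition int_defect (a : nat) (f : nat -> nat -> int) (r c : nat) : int :=
  int_sum 7 (fun k => f r k * oct_entry a c k)
  - int_sum 7 (fun k => oct_entry a k r * f k c)
  - int_sum 7 (fun b => f b a * oct_entry b c r).

Lemma oct_formE (a b c : 'I_7) : oct_form R a b c = (oct_entry a b c)%:~R.
Proof. by rewrite /oct_form rmorphB /= !mulrz_nat. Qed.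

Lemma derivation_defect_int a f :
  derivation_defect a (int_mx 7 f) = int_mx 7 (int_defect a f).
Proof.
apply/matrixP => r c; rewrite /derivation_defect !mxE summxE.
rewrite !rmorphB /= -!int_sumE; congr (_ - _ - _); apply: eq_bigr => k _;
  by rewrite !mxE oct_formE intrM.
Qed.

Lemma g2_mem (a : 'I_7) (t : nat) :
  t \in [:: 1; 2; 4]%N -> int_mx 7 (g2_entry a t) \in g2_alg R.
Proof.
move=> t124; rewrite mem_g2_alg; apply/andP; split.
  have comp : all_below 7 (fun a => all (fun t => all_below 7 (fun r =>
    all_below 7 (fun c => g2_entry a t c r == - g2_entry a t r c)))
    [:: 1; 2; 4]%N) by vm_compute.
  exact/eqP/int_mx_skew/(allP (all_belowP comp a) _ t124).
apply/forallP => b; rewrite derivation_defect_int; apply/eqP.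
transitivity (int_mx 7 (fun _ _ => 0)).
  2: by apply/matrixP => r c; rewrite !mxE.
apply: int_mx_eq.
have comp : all_below 7 (fun a => all (fun t => all_below 7 (fun b =>
  all_below 7 (fun r => all_below 7 (fun c =>
    int_defect b (g2_entry a t) r c == 0)))) [:: 1; 2; 4]%N) by vm_compute.
exact: all_belowP (allP (all_belowP comp a) _ t124) b.
Qed.

(** Two points i, j determine a line, whose third point is a. *)
Lemma g2_planes : has_planes (g2_alg R).
Proof.
move=> i j ij.
have comp : all_below 7 (fun i => all_below 7 (fun j => (i != j) ==>
  has (fun a => has (fun t => (t \in [:: 1; 2; 4]%N) &&
    int_plane_preserving 7 (g2_entry a t) i j) (iota 0 5)) (iota 0 7)))
  by vm_compute.
have := all_belowP (all_belowP comp i) j; rewrite ij => /has_belowP[a].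
move=> /has_belowP[t /andP[t124 planes]].
exists (int_mx 7 (g2_entry a t)); first exact: g2_mem.
exact: int_mx_plane_preserving.
Qed.

Definition clifford_entry (a r c : nat) : int :=
  match r, c with
  | 0%N, 0%N => 0
  | 0%N, c'.+1 => - (a == c')%:R
  | r'.+1, 0%N => (a == r')%:R
  | r'.+1, c'.+1 => oct_entry a c' r'
  end.

Lemma oct_cliffordE (a : 'I_7) : oct_clifford R a = int_mx 8 (clifford_entry a).
Proof.
apply/matrixP => r c; rewrite [RHS]mxE /oct_clifford.
rewrite -[r]splitK -[c]splitK.
case: (split r) => r'; case: (split c) => c'; rewrite /= ?(ord1 r') ?(ord1 c').
- by rewrite block_mxEul mxE.
- by rewrite block_mxEur !mxE eqxx /= add0n eq_sym rmorphN /= mulrz_nat.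
- by rewrite block_mxEdl !mxE eqxx /= add0n andbT mulrz_nat eq_sym.
- by rewrite block_mxEdr !mxE /= !add0n oct_formE.
Qed.

Lemma oct_clifford_skew (a : 'I_7) : (oct_clifford R a)^T = - oct_clifford R a.
Proof.
rewrite oct_cliffordE; apply: int_mx_skew.
have comp : all_below 7 (fun a => all_below 8 (fun r => all_below 8 (fun c =>
  clifford_entry a c r == - clifford_entry a r c))) by vm_compute.
exact: all_belowP comp a.
Qed.

(** For octonion units e_i and e_j some x |-> e_a (e_b x) maps one to the
    other up to sign, and all these maps are signed permutations of the
    basis. *)
Lemma spin7_planes : has_planes (spin7_alg R).
Proof.
move=> i j ij.
have comp : all_below 8 (fun i => all_below 8 (fun j => (i != j) ==>
  has (fun a => has (fun b => (a < b)%N && int_plane_preserving 8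
    (int_mul 8 (clifford_entry a) (clifford_entry b)) i j)
    (iota 0 7)) (iota 0 7))) by vm_compute.
have := all_belowP (all_belowP comp i) j; rewrite ij => /has_belowP[a].
move=> /has_belowP[b /andP[ab planes]].
exists (oct_clifford R a *m oct_clifford R b : 'M[R]_8).
  exact: (@mem_sum_lines _ _ _ _ (fun a b : 'I_7 => (a < b)%N)
    (fun a b => oct_clifford R a *m oct_clifford R b : 'M[R]_8)).
by rewrite !oct_cliffordE int_mx_mul; apply: int_mx_plane_preserving.
Qed.

(** * The seven families *)
Lemma holonomy_planes N (g : {vspace 'M[R]_N}) :
  holonomy_algebra g -> has_planes g.
Proof.
case=> *; [exact: so_planes | exact: u_planes | exact: su_planes
  | exact: sp1_sp_planes | exact: sp_planes | exact: g2_planes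
  | exact: spin7_planes].
Qed.

Lemma sp1_sub_so n : (<<quaternionic_structures R n>> <= so_alg R (n * 4))%VS.
Proof.
apply/span_subvP => J; rewrite mem_so_alg => JQ.
have skew Q : Q^T = - Q :> 'M[R]_4 ->
    (1%:M *t Q : 'M[R]_(n * 4))^T = - (1%:M *t Q).
  move=> skQ; rewrite trmx_tens skQ trmx1.
  by apply/matrixP => r c; rewrite !mxE mulrN.
apply/eqP; move: JQ; rewrite !inE => /or3P[] /eqP ->; apply: skew;
  rewrite /rmul_i /rmul_j /rmul_k mx_of_rowsE;
  by apply: int_mx_skew; vm_compute.
Qed.

(** Skewness of e_a e_b for a, b distinct is the Clifford relation. *)
Lemma spin7_sub_so : (spin7_alg R <= so_alg R 8)%VS.
Proof.
apply/subv_sumP => a _; apply/subv_sumP => b ab.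
rewrite -memvE mem_so_alg trmx_mul !oct_clifford_skew mulNmx mulmxN opprK.
have := oct_cliffordP R a b; rewrite -val_eqE (ltn_eqF ab) oppr0 mul0rn raddf0.
by move=> /eqP; rewrite addrC addr_eq0.
Qed.

Lemma holonomy_sub_so N (g : {vspace 'M[R]_N}) :
  holonomy_algebra g -> (g <= so_alg R N)%VS.
Proof.
case=> *.
- exact: subvv.
- exact: capvSl.
- exact: subv_trans (su_sub_u _) (capvSl _ _).
- by rewrite subv_add sp1_sub_so capvSl.
- exact: capvSl.
- exact: capvSl.
exact: spin7_sub_so.
Qed.

Lemma holonomy_dim_gt0 N (g : {vspace 'M[R]_N}) :
  holonomy_algebra g -> (0 < N)%N.
Proof. by case=> // n n_gt; rewrite ?muln_gt0 ?(ltnW n_gt) ?n_gt. Qed.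

End Planes.

(** * Passage to the complexification *)
Lemma lie_bracket_complex (F : fieldType) n (i : F) (A B A' B' : 'M[F]_n) :
  i * i = -1 ->
  lie_bracket (A + i *: B) (A' + i *: B') =
  lie_bracket A A' - lie_bracket B B'
  + i *: (lie_bracket A B' + lie_bracket B A').
Proof.
move=> i2; rewrite /lie_bracket !(mulmxDl, mulmxDr) -!(scalemxAl, scalemxAr).
rewrite !scalerA i2.
move: (A *m A') (A' *m A) (A *m B') (B' *m A) => p p' q q'.
move: (B *m A') (A' *m B) (B *m B') (B' *m B) => r r' s s'.
by apply/matrixP => k l; rewrite !mxE; ring.
Qed.

Section Complexification.
Variables (R : realType) (N : nat).
Implicit Types g h : {vspace 'M[R]_N}.
Local Notation cplx := (map_mx (real_complex R)).

Lemma complexify_real g X : X \in g -> cplx X \in complexify g.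
Proof.
move=> Xg; apply/mem_complexify; exists X, 0.
by rewrite Xg mem0v map_mx0 scaler0 addr0.
Qed.

Lemma complex_i2 : 'i%C * 'i%C = -1 :> R[i].
Proof. by rewrite -expr2 sqr_i. Qed.

Lemma complexify_ideal g h :
  is_ideal g h -> is_ideal (complexify g) (complexify h).
Proof.
move=> [/subvP hg idl]; split.
  apply/subvP => X /mem_complexify[A [B [Ah Bh ->]]].
  by apply/mem_complexify; exists A, B; split=> //; apply: hg.
move=> X Y /mem_complexify[A [B [Ag Bg ->]]].
move=> /mem_complexify[A' [B' [A'h B'h ->]]].
apply/mem_complexify.
exists (lie_bracket A A' - lie_bracket B B').
exists (lie_bracket A B' + lie_bracket B A'); split.
- by rewrite rpredB ?idl.
- by rewrite rpredD ?idl.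
rewrite (lie_bracket_complex _ _ _ _ (complex_i2)) !map_mxB map_mxD.
by rewrite /lie_bracket !map_mxB !map_mxM.
Qed.

Lemma complexify_skew g X :
  (g <= so_alg R N)%VS -> X \in complexify g -> X^T = - X.
Proof.
move=> /subvP g_so /mem_complexify[A [B [/g_so As /g_so Bs ->]]].
move: As Bs; rewrite !mem_so_alg => /eqP As /eqP Bs.
by rewrite linearD linearZ /= !map_trmx As Bs !map_mxN scalerN opprD.
Qed.

(** A real matrix that preserves a coordinate plane does so over the complex
    numbers, where the criterion holds as well. *)
Lemma complex_symmetric_commuting_scalar g (S : 'M[R[i]]_N) :
  (g <= so_alg R N)%VS -> has_planes g -> S^T = S ->
  (forall X, X \in complexify g -> X *m S = S *m X) -> exists c, S = c%:M.
Proof.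
move=> g_so planes symS comm; apply: symmetric_commuting_scalar => // [|i j ij].
  by rewrite pnatr_eq0.
have [X Xg [Xij Xi Xj]] := planes i j ij.
have Xc := complexify_real Xg.
exists (cplx X); split; [exact: complexify_skew Xc| |by rewrite comm].
split=> [|k kj|k ki]; first by rewrite mxE fmorph_eq0.
  by rewrite mxE Xi ?rmorph0.
by rewrite mxE Xj ?rmorph0.
Qed.

End Complexification.

(** * The theorem *)
Theorem theorem4p1 (R : realType) (N : nat)
    (gR hR : {vspace 'M[R]_N})
    (hol_gR : holonomy_algebra gR) (ideal_hR : is_ideal gR hR)
    (m : nat) (rho : 'M[R[i]]_N -> 'M[R[i]]_m)
    (rep_rho : is_representation (complexify gR) rho)
    (irr_rho : is_irreducible (complexify gR) rho)
    (Xs : (\dim (complexify hR)).-tuple 'M[R[i]]_N)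
    (onb_Xs : orthonormal_basis (complexify hR) Xs) :
  let K := K_op m Xs in
  let B := B_op rho Xs in
  let tau := tau_op R[i] N m in
  exists cas_T : R[i],
    [/\ casimir Xs = cas_T%:M,
        (forall F : 'M[R[i]]_(m, N * N * m),
           in_W (complexify gR) rho F ->
           F *m (K + B + tau *m B *m tau) = cas_T *: F) &
        cas_T = - (2%:R * ((\dim (complexify hR))%:R / N%:R))].
Proof.
move=> K B tau.
have g_so := holonomy_sub_so hol_gR.
have planes := holonomy_planes hol_gR.
have ideal_h := complexify_ideal ideal_hR.
have [/subvP hg _] := ideal_h.
have Xsg i : tnth Xs i \in complexify gR by exact/hg/(orthonormal_mem i onb_Xs).
have C2 : 2%:R != 0 :> R[i] by rewrite pnatr_eq0.
have symC : (casimir Xs)^T = casimir Xs.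
  by apply: casimir_sym => i; apply: complexify_skew g_so (Xsg i).
have [cT casT] : exists c, casimir Xs = c%:M.
  apply: (complex_symmetric_commuting_scalar g_so planes symC) => X Xg.
  exact: casimir_in_commutes (identity_representation _) ideal_h onb_Xs Xg.
have [cV casV] : exists c, casimir_in rho Xs = c%:M.
  apply: (schur_scalar irr_rho) => X Xg.
  exact: casimir_in_commutes rep_rho ideal_h onb_Xs Xg.
exists cT; split=> // [F FW|]; first exact: in_W_casimir FW casT casV.
have N0 : N%:R != 0 :> R[i].
  by rewrite pnatr_eq0 -lt0n (holonomy_dim_gt0 hol_gR).
apply: (mulIf N0); have := casimir_trace C2 onb_Xs.
rewrite casT mxtrace_scalar -[cT *+ _]mulr_natr => ->.
by rewrite mulNr -mulrA divfK.
Qed.
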